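(* Let $d\geq 1$ and let $\mathcal{F}=\{C_0,\ldots,C_d\}$ be a $d$-critical family in $\mathbb{R}^d$. Then there exist $d+1$ base points $p_0,\ldots,p_d$, with $p_i\in\bigcap_{h\neq i}C_h$ for $0\leq i\leq d$, which belong to every convex cage $M$ carried by $\mathcal{F}$.
   Context: A family of compact convex sets $C_0,C_1,\ldots,C_n\subset\mathbb{R}^d$ is called an $n$-critical family if $\bigcap_{i\neq j}C_i\neq\varnothing$ for every $j=0,1,\ldots,n$ (the intersection being over $i\in\{0,\ldots,n\}$, $i\neq j$), but $\bigcap_{i=0}^n C_i=\varnothing$. Here this is used with $n=d$. Given a $d$-critical family $\mathcal{F}=\{C_0,\ldots,C_d\}$ in $\mathbb{R}^d$, a cage (carried by $\mathcal{F}$) is a closed set $M\subseteq\mathbb{R}^d$ containing $d+1$ points $a_0,\ldots,a_d$, called base points, with $a_i\in\bigcap_{h\neq i}C_h$ for $0\leq i\leq d$. A convex cage is a cage that is a convex set. *)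

(* Defs.v *)
From mathcomp Require Import all_boot all_order all_algebra.
From mathcomp Require Import all_classical all_reals all_analysis.
Import numFieldNormedType.Exports.

Set Implicit Arguments.
Unset Strict Implicit.
Unset Printing Implicit Defensive.

Local Open Scope classical_set_scope.
Local Open Scope ring_scope.

(* The space R^d is 'rV[R]_d with its normed topology (sup norm), which is the
   usual Euclidean topology. *)

Definition bigcap_except (T : Type) (n : nat) (C : 'I_n.+1 -> set T)
    (j : 'I_n.+1) : set T :=
  \bigcap_(i in [set i | i != j]) C i.

(* A family C_0, ..., C_n is indexed by 'I_n.+1; criticality forces its members
   to be pairwise distinct, so indexed and unindexed families agree. *)
Definition critical_family (R : realType) (d n : nat)
    (C : 'I_n.+1 -> set 'rV[R]_d) : Prop :=
  [/\ forall i, compact (C i),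
      forall i, convex_set (C i),
      forall j, bigcap_except C j !=set0
    & \bigcap_i C i = set0].

(* For a critical family, base points are automatically pairwise distinct: if
   a i = a j with i != j, this point would lie in every C h. *)
Definition base_points (R : realType) (d : nat) (C : 'I_d.+1 -> set 'rV[R]_d)
    (a : 'I_d.+1 -> 'rV[R]_d) : Prop :=
  forall i, bigcap_except C i (a i).

Definition cage (R : realType) (d : nat) (C : 'I_d.+1 -> set 'rV[R]_d)
    (M : set 'rV[R]_d) : Prop :=
  closed M /\ exists2 a : 'I_d.+1 -> 'rV[R]_d,
    base_points C a & forall i, M (a i).

Definition convex_cage (R : realType) (d : nat) (C : 'I_d.+1 -> set 'rV[R]_d)
    (M : set 'rV[R]_d) : Prop :=
  cage C M /\ convex_set M.

(* Main.v *)
(** Base points are affinely independent: a Radon point of them would lie in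
    every [C i].  Choose base points [p] spanning a simplex of minimal volume.
    If [x] is another candidate for the [i]-th base point, the Radon point of
    [p] and [x] is again such a candidate and lies in the simplex of [p], so
    minimality forces it to be [p i]; hence all barycentric coordinates of [x]
    in [p] other than the [i]-th are nonpositive.  For arbitrary base points
    [a], the matrix [A] of their coordinates in [p] therefore has nonpositive
    off-diagonal entries and row sums 1, which makes its inverse nonnegative:
    each [p i] is a convex combination of the [a j]. *)

Require Import Defs.
From mathcomp Require Import all_boot all_order all_algebra.
From mathcomp Require Import all_classical all_reals all_analysis.
Import numFieldNormedType.Exports.

Local Open Scope classical_set_scope.
Local Open Scope ring_scope.
Import Order.TTheory GRing.Theory Num.Theory.

Lemma convex_set_sum {R : realFieldType} {V : lmodType R} (A : set V)
    (T : Type) (s : seq T) (w : T -> R) (q : T -> V) :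
  convex_set A -> (forall t, 0 <= w t) -> (forall t, 0 < w t -> A (q t)) ->
  0 < \sum_(t <- s) w t ->
  A ((\sum_(t <- s) w t)^-1 *: \sum_(t <- s) w t *: q t).
Proof.
move=> cA w0 Aq.
(* Division by the total is postponed so that the induction passes through tails of zero weight,
   where [y] is unconstrained. *)
suff [y Ay ->] : exists2 y, 0 < \sum_(t <- s) w t -> A y &
    \sum_(t <- s) w t *: q t = (\sum_(t <- s) w t) *: y.
  by move=> s0; rewrite scalerA mulVf ?gt_eqF// scale1r; exact: Ay.
elim: s => [|t s [y Ay IH]].
  by exists 0; rewrite !big_nil ?ltxx// scaler0.
rewrite !big_cons IH.
have S0 : 0 <= \sum_(j <- s) w j by apply: sumr_ge0.
set S := \sum_(j <- s) w j in Ay S0 *.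
have := w0 t; rewrite le_eqVlt => /predU1P[<-|wt0].
  by exists y; rewrite ?scale0r !add0r.
move: S0; rewrite le_eqVlt => /predU1P[<-|S0].
  by exists (q t) => [_|]; [exact: Aq|rewrite scale0r !addr0].
have wS0 : 0 < w t + S by rewrite addr_gt0.
have k0 : 0 <= w t / (w t + S) by rewrite divr_ge0// ltW.
have k1 : w t / (w t + S) <= 1 by rewrite ler_pdivrMr// mul1r lerDl ltW.
exists (conv (Itv01 k0 k1) (q t : convex_lmodType V) y) => [_|].
  by apply/set_mem/cA; rewrite inE; [exact: Aq|exact: Ay].
rewrite /conv/= /unstable.onem scalerDr !scalerA mulrBr mulr1 mulrCA mulfV ?gt_eqF//.
by rewrite mulr1 [w t + S]addrC addrK.
Qed.

(** The positive and negative parts of an affine dependence have the same total weight and the same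
    barycenter, so it suffices that the points of one sign lie in [A]. *)
Lemma radon_point {R : realFieldType} {V : lmodType R} (A : set V)
    (T : Type) (s : seq T) (w : T -> R) (q : T -> V) :
  convex_set A -> \sum_(t <- s) w t = 0 -> \sum_(t <- s) w t *: q t = 0 ->
  (forall t, 0 < w t -> A (q t)) \/ (forall t, w t < 0 -> A (q t)) ->
  let N := \sum_(t <- s) Num.max (w t) 0 in 0 < N ->
  A (N^-1 *: \sum_(t <- s) Num.max (w t) 0 *: q t).
Proof.
move=> cA w0 wq0 [Aq|Aq] N N0.
  apply: convex_set_sum => // t; first by rewrite le_max lexx orbT.
  by rewrite lt_max ltxx orbF; exact: Aq.
have wE t : Num.max (w t) 0 = w t + Num.max (- w t) 0.
  by rewrite addr_maxr subrr addr0 maxC.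
have NE : N = \sum_(t <- s) Num.max (- w t) 0.
  by rewrite /N; under eq_bigr do rewrite wE; rewrite big_split/= w0 add0r.
have -> : \sum_(t <- s) Num.max (w t) 0 *: q t =
          \sum_(t <- s) Num.max (- w t) 0 *: q t.
  under eq_bigr do rewrite wE scalerDl.
  by rewrite big_split/= wq0 add0r.
rewrite NE in N0 *.
apply: convex_set_sum => // t; first by rewrite le_max lexx orbT.
by rewrite lt_max ltxx orbF oppr_gt0; exact: Aq.
Qed.

(** A form of Cramer's rule: the cofactors along row [i] do not see that row, so [A] and [B] share
    them. *)
Lemma det_replace_row {R : comPzRingType} {n : nat} (A B : 'M[R]_n) (i : 'I_n)
    (u : 'rV[R]_n) :
  row i B = u *m A -> row' i B = row' i A -> \det B = u 0 i * \det A.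
Proof.
move=> rB rA; rewrite (expand_det_row _ i).
transitivity ((u *m A *m \adj A) 0 i).
  rewrite mxE; apply: eq_bigr => j _.
  rewrite -rB !mxE; congr (_ * _).
  rewrite /cofactor; congr (_ * \det _).
  by apply/matrixP => k l; have /matrixP/(_ k (lift j l)) := rA; rewrite !mxE.
by rewrite -mulmxA mul_mx_adj mul_mx_scalar mxE mulrC.
Qed.

Lemma continuous_det {R : numFieldType} {T : topologicalType} {n : nat}
    (f : T -> 'M[R]_n) :
  (forall i j, continuous (fun x => f x i j)) ->
  continuous (fun x => \det (f x)).
Proof.
move=> cf x; apply: (cvg_big add_continuous) => s _.
apply: cvgM; first exact: cvg_cst.
by apply: (cvg_big mul_continuous) => i _; exact: cf.
Qed.

(* Looking at the row [k] where column [j] of [B] is smallest, [(A *m B) k j] is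
   at most [B k j]. *)
Lemma Zmatrix_inv_ge0 {R : realFieldType} {n : nat} (A B : 'M[R]_n) :
  A *m B = 1%:M -> (forall i, \sum_j A i j = 1) ->
  (forall i j, j != i -> A i j <= 0) -> forall i j, 0 <= B i j.
Proof.
move=> AB sA A0 i j.
have [k _ kmin] := @arg_minP _ _ _ i predT (fun l => B l j) isT.
apply: le_trans (kmin i isT).
have : 0 <= \sum_l A k l * B l j.
  by have /matrixP/(_ k j) := AB; rewrite !mxE => ->; case: eqP.
move/le_trans; apply; rewrite -[leRHS]mul1r -(sA k) mulr_suml.
apply: ler_sum => l _; have [->//|lk] := eqVneq l k.
by rewrite ler_wnM2l ?A0 ?kmin.
Qed.

(* The determinant of [homog a] is, up to sign, [d!] times the volume of the
   simplex with vertices [a]. *)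
Definition homog {R : pzRingType} {d : nat} (a : 'I_d.+1 -> 'rV[R]_d) :
  'M[R]_d.+1 := row_mx (const_mx 1 : 'cV_d.+1) (\matrix_i a i).

(** The column of ones turns affine dependences of the points into linear dependences of the
    rows. *)
Lemma mul_homog {R : pzRingType} {d : nat} (u : 'rV[R]_d.+1)
    (a : 'I_d.+1 -> 'rV[R]_d) :
  u *m homog a =
  row_mx (\sum_i u 0 i)%:M (\sum_i u 0 i *: a i) :> 'rV[R]_(1 + d).
Proof.
rewrite /homog (mul_mx_row (p1 := 1) (p2 := d)); congr row_mx.
  apply/rowP => j; rewrite !ord1 !mxE eqxx mulr1n.
  by apply: eq_bigr => i _; rewrite mxE mulr1.
by rewrite mulmx_sum_row; apply: eq_bigr => i _; rewrite rowK.
Qed.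

Lemma row_homog {R : pzRingType} {d : nat} (a : 'I_d.+1 -> 'rV[R]_d) i :
  row i (homog a) = row_mx 1%:M (a i) :> 'rV[R]_(1 + d).
Proof.
rewrite /homog (row_row_mx (n1 := 1) (n2 := d)) rowK; congr row_mx.
by apply/rowP => j; rewrite !ord1 !mxE eqxx.
Qed.

Lemma coord_homog {R : pzRingType} {d : nat} {a b : 'I_d.+1 -> 'rV[R]_d}
    {L : 'M[R]_d.+1} :
  homog a = L *m homog b ->
  forall i, \sum_j L i j = 1 /\ a i = \sum_j L i j *: b j.
Proof.
move=> aE i; have rE j : row i L 0 j = L i j by rewrite mxE.
have := row_homog a i; rewrite aE row_mul mul_homog.
move=> /(@eq_row_mx _ 1 1 d)[/matrixP/(_ 0 0)].
rewrite !mxE eqxx !mulr1n => <- <-.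
by split; apply: eq_bigr => j _; rewrite rE.
Qed.

Lemma continuous_homog {R : realType} {d : nat} (i j : 'I_d.+1) :
  continuous (fun a : prod_topology (fun=> 'rV[R]_d) => homog a i j).
Proof.
rewrite /homog => a.
have [k ->|k ->] := split_ordP (j : 'I_(1 + d)).
- under [X in continuous_at _ X]eq_fun do rewrite (row_mxEl (n1 := 1) (n2 := d)) mxE.
  exact: cst_continuous.
under [X in continuous_at _ X]eq_fun do rewrite (row_mxEr (n1 := 1) (n2 := d)) mxE.
have := @continuous_comp (prod_topology (fun=> 'rV[R]_d)) 'rV[R]_d R
  (proj i) (fun v => v 0 k) a.
by apply; [exact: proj_continuous|exact: coord_continuous].
Qed.

Lemma base_point_in {R : realType} {d : nat} {C : 'I_d.+1 -> set 'rV[R]_d}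
    {a : 'I_d.+1 -> 'rV[R]_d} {i j : 'I_d.+1} :
  base_points C a -> j != i -> C j (a i).
Proof. by move=> aC; exact: aC. Qed.

(** A nonzero left kernel vector is an affine dependence of the [a i]. The index [j] misses at least
    one of the two sign classes, and [C j] contains all points of that class, hence the Radon point;
    this holds for every [j]. *)
Lemma homog_unit {R : realType} {d : nat} {C : 'I_d.+1 -> set 'rV[R]_d}
    (hC : critical_family C) {a : 'I_d.+1 -> 'rV[R]_d} :
  base_points C a -> homog a \in unitmx.
Proof.
have [_ cC _ C0] := hC => aC; rewrite unitmxE unitfE; apply/negP => /det0P[u u0].
rewrite mul_homog -(row_mx0 _ _ 1 d) => /(@eq_row_mx _ 1 1 d)[su0 sa0].
have {}su0 : \sum_i u 0 i = 0.
  by have /matrixP/(_ 0 0) := su0; rewrite !mxE eqxx mulr1n.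
have N0 : 0 < \sum_i Num.max (u 0 i) 0.
  have m0 i : true -> 0 <= Num.max (u 0 i) 0 by rewrite le_max lexx orbT.
  rewrite lt_neqAle sumr_ge0 ?andbT// eq_sym; apply/negP => /eqP.
  move=> /(psumr_eq0P m0) um0.
  have un i : 0 <= - u 0 i.
    by rewrite oppr_ge0 -(um0 i isT) le_max lexx.
  have : \sum_i (- u 0 i) = 0 by rewrite sumrN su0 oppr0.
  move/(psumr_eq0P (fun i _ => un i)) => uz; case/negP: u0; apply/eqP/rowP => i.
  by apply: oppr_inj; rewrite (uz i)// mxE oppr0.
suff : (\bigcap_i C i) ((\sum_i Num.max (u 0 i) 0)^-1 *:
           \sum_i Num.max (u 0 i) 0 *: a i) by rewrite C0.
move=> j _; apply: radon_point => //.
have [uj|uj] := ltP 0 (u 0 j); [right|left] => t ut; apply: (base_point_in aC).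
  by apply: contraTneq ut => <-; rewrite -leNgt ltW.
by apply: contraTneq ut => <-; rewrite -leNgt.
Qed.

(* The point obtained is the Radon point of [p] and [x := \sum_j mu j *: p j],
   for the affine dependence with coefficient -1 at [x]. *)
Lemma exchange {R : realType} {d : nat} {C : 'I_d.+1 -> set 'rV[R]_d}
    (hC : critical_family C) {p : 'I_d.+1 -> 'rV[R]_d} {mu : 'I_d.+1 -> R} {i} :
  base_points C p -> \sum_j mu j = 1 ->
  bigcap_except C i (\sum_j mu j *: p j) ->
  let N := \sum_j Num.max (mu j) 0 in
  0 < N /\ bigcap_except C i (N^-1 *: \sum_j Num.max (mu j) 0 *: p j).
Proof.
have [_ cC _ _] := hC => pC mu1 xK N.
have N0 : 0 < N.
  by rewrite (lt_le_trans ltr01)// -mu1 ler_sum// => j _; rewrite le_max lexx.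
split=> // j /= ji.
pose x := \sum_j mu j *: p j.
pose w t := if t is Some k then mu k else -1.
pose q t := if t is Some k then p k else x.
pose s := None :: map Some (index_enum 'I_d.+1).
have m0 : Num.max (-1 : R) 0 = 0 by apply/max_idPr; rewrite oppr_le0.
have NE : N = \sum_(t <- s) Num.max (w t) 0.
  by rewrite big_cons big_map/= m0 add0r.
have -> : \sum_j Num.max (mu j) 0 *: p j = \sum_(t <- s) Num.max (w t) 0 *: q t.
  by rewrite [RHS]big_cons big_map/= m0 scale0r add0r.
rewrite NE in N0 *; apply: radon_point => //.
- by rewrite big_cons big_map/= mu1 addNr.
- by rewrite big_cons big_map/= scaleN1r addNr.
(* Take the side of the dependence that avoids [p j], the only point that may lie outside [C j]; [x]
   itself is in [C j] because [j != i]. *)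
have [muj|muj] := ltP 0 (mu j); [right|left] => -[t|]/=.
- move=> mt; apply: (base_point_in pC).
  by apply: contraTneq mt => <-; rewrite -leNgt ltW.
- by move=> _; exact: xK.
- move=> mt; apply: (base_point_in pC).
  by apply: contraTneq mt => <-; rewrite -leNgt.
- by rewrite ltr0N1.
Qed.

Lemma min_det_coord_le0 {R : realType} {d : nat} {C : 'I_d.+1 -> set 'rV[R]_d}
    (hC : critical_family C) {p : 'I_d.+1 -> 'rV[R]_d} {mu : 'I_d.+1 -> R} {i} :
  base_points C p ->
  (forall a, base_points C a -> `|\det (homog p)| <= `|\det (homog a)|) ->
  \sum_j mu j = 1 -> bigcap_except C i (\sum_j mu j *: p j) ->
  forall j, j != i -> mu j <= 0.
Proof.
move=> pC pmin mu1 xK j ji.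
have [] := exchange hC pC mu1 xK.
set N := \sum_j _ => N0 cK.
pose c k := if k == i then N^-1 *: \sum_j Num.max (mu j) 0 *: p j else p k.
have cC : base_points C c by move=> k; rewrite /c; case: eqP => [->|].
(* Barycentric coordinates in [p] of the new vertex. Minimality forces [1 <= l 0 i], that is
   [N <= Num.max (mu i) 0], so the other positive parts vanish. *)
pose l := \row_j (N^-1 * Num.max (mu j) 0).
have dc : \det (homog c) = l 0 i * \det (homog p).
  apply: det_replace_row.
    rewrite row_homog mul_homog /c eqxx; congr (@row_mx R 1 1 d _ _).
      congr (_%:M); under eq_bigr do rewrite mxE.
      by rewrite -mulr_sumr mulVf ?gt_eqF.
    by rewrite scaler_sumr; apply: eq_bigr => k _; rewrite mxE scalerA.
  apply/matrixP => k m.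
  have /rowP/(_ m) : row (lift i k) (homog c) = row (lift i k) (homog p).
    by rewrite !row_homog /c eq_sym (negbTE (neq_lift _ _)).
  by rewrite !mxE.
have dp0 : 0 < `|\det (homog p)|.
  by rewrite normr_gt0 -unitfE -unitmxE (homog_unit hC).
have m0 k : 0 <= Num.max (mu k) 0 by rewrite le_max lexx orbT.
have := pmin _ cC.
rewrite dc normrM ler_pMl// mxE ger0_norm; last first.
  by rewrite mulr_ge0// invr_ge0 ltW.
rewrite mulrC ler_pdivlMr// mul1r /N (bigD1 i)//= gerDl (bigD1 j)//= => le0.
suff : Num.max (mu j) 0 <= 0 by rewrite ge_max lexx andbT.
by apply: le_trans le0; rewrite lerDl sumr_ge0.
Qed.

Lemma exists_min_det {R : realType} {d : nat} {C : 'I_d.+1 -> set 'rV[R]_d}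
    (hd : (1 <= d)%N) (hC : critical_family C) :
  exists2 p, base_points C p &
    forall a, base_points C a -> `|\det (homog p)| <= `|\det (homog a)|.
Proof.
have [kC _ C0 _] := hC.
have kK i : compact (bigcap_except C i).
  (* As [1 <= d], the intersection is over a nonempty index set and so lies in a compact [C j]. *)
  have [j ji] : exists j : 'I_d.+1, j != i.
    have [->|i0] := eqVneq i 0; last by exists 0; rewrite eq_sym.
    by exists ord_max; rewrite -lt0n.
  apply: subclosed_compact (kC j) _; last by move=> x; exact.
  apply: closed_bigI => k _; apply: compact_closed (kC k).
  exact: norm_hausdorff.
have [||p|p] := @compact_EVT_min (prod_topology (fun=> 'rV[R]_d)) R
  (fun a => `|\det (homog a)|) [set a | forall i, bigcap_except C i (a i)].
- by exists (fun i => xget 0 (bigcap_except C i)) => i; apply: xgetPex (C0 i).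
- exact: tychonoff.
- apply: continuous_subspaceT => a.
  exact: cvg_norm (continuous_det _ continuous_homog a).
by rewrite inE => pC pmin; exists p => // a aC; apply: pmin; rewrite inE.
Qed.

Theorem theorem3p2 (R : realType) (d : nat) (hd : (1 <= d)%N)
    (C : 'I_d.+1 -> set 'rV[R]_d) (hC : critical_family C) :
  exists p : 'I_d.+1 -> 'rV[R]_d,
    base_points C p /\
    forall M : set 'rV[R]_d, convex_cage C M -> forall i, M (p i).
Proof.
have [p pC pmin] := exists_min_det hd hC; exists p; split=> // M.
move=> [[_ [a aC Ma]] cM] i.
have pU := homog_unit hC pC; have aU := homog_unit hC aC.
(* Row [k] of [A] holds the barycentric coordinates of [a k] in [p]; row [k] of [B] those of [p k]
   in [a]. *)
pose A := homog a *m invmx (homog p).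
pose B := homog p *m invmx (homog a).
have aA : homog a = A *m homog p by rewrite mulmxKV.
have pB : homog p = B *m homog a by rewrite mulmxKV.
have AB : A *m B = 1%:M by rewrite /A /B mulmxA mulmxKV// mulmxV.
have B0 : forall k j, 0 <= B k j.
  apply: (Zmatrix_inv_ge0 _ _ AB) => k; first by have [] := coord_homog aA k.
  have [A1 aE] := coord_homog aA k; apply: (min_det_coord_le0 hC pC pmin A1).
  by rewrite -aE; exact: aC.
have [B1 ->] := coord_homog pB i.
(* The total weight 1 is made explicit to match the normalised form of [convex_set_sum]. *)
rewrite -[X in M X]scale1r -[X in X *: _]invr1 -{1}B1.
by apply: convex_set_sum => //; rewrite B1.
Qed.
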